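(* Let $p$ and $q$ be distinct primes. Let $1\le p^*\le q-1$ be the inverse of $p$ modulo $q$. Then $$B_{-}(p^2q)=\min(p,p^* )+\min(p,q-p^* )\quad\text{and}\quad B_{+}(p^2q)=\min(p^2,q).$$
   Context: For a positive integer $n$, $B_{+}(n)$ denotes the maximum among all the coefficients of all the monic divisors in $\mathbb{Z}[x]$ of $x^n-1$, and $-B_{-}(n)$ denotes the minimum among all the coefficients of all the monic divisors in $\mathbb{Z}[x]$ of $x^n-1$. *)

(* Defs.v *)
From mathcomp Require Import all_boot all_order all_algebra.
Set Implicit Arguments.
Unset Strict Implicit.
Unset Printing Implicit Defensive.
Import Order.TTheory GRing.Theory Num.Theory.
Local Open Scope ring_scope.

(* Divisibility is spelled out because [%|] on {poly int} is pseudo-division,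
   i.e. divisibility up to a nonzero integer factor. *)
Definition monic_divisor (n : nat) (f : {poly int}) : Prop :=
  f \is monic /\ exists g : {poly int}, 'X^n - 1 = f * g.

Definition divisor_coef (n : nat) (c : int) : Prop :=
  exists f : {poly int}, monic_divisor n f /\
    exists2 i : nat, (i < size f)%N & c = f`_i.

(* For a positive integer n, B_+(n) is the unique b with [is_Bplus n b]:
   the maximum of the coefficients, attained. *)
Definition is_Bplus (n : nat) (b : int) : Prop :=
  divisor_coef n b /\ forall c : int, divisor_coef n c -> c <= b.

(* The sign convention makes - B_-(n) the minimum of the coefficients. *)
Definition is_Bminus (n : nat) (b : int) : Prop :=
  divisor_coef n (- b) /\ forall c : int, divisor_coef n c -> - b <= c.

(* Main.v *)
(** [X^(p^2 q) - 1] is the product of six cyclotomic polynomials, each prime in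
    Z[X], so its monic divisors are the 64 products of subsets of them. Writing
    [n]_d = 1 + X^d + ... + X^(d(n-1)), each of the 32 subsets without [Phi_1]
    reduces to products of such geometric sums and of [Phi_pq], [Phi_p2q]; most
    of these products have coefficients in {-1, 0, 1}, so that the factor X - 1
    raises the height to at most 2.  The maximum is attained by
    [Phi_p Phi_p2 Phi_q] = [p^2]_1 [q]_1.  The minimum is attained by
    [Phi_1 Phi_p2 Phi_pq]: with p mu + q la = pq + 1 (so that mu = pstar),
      Phi_p2 Phi_pq = [mu]_p [p]_p [la]_q - X [q-mu]_p [p]_p [p-la]_q,
    whose coefficients lie between - min(p, q-mu) and min(p, mu).  Both bounds
    are attained, at the consecutive exponents pq-p-q and pq-p-q+1, because the
    Frobenius number pq-p-q is not of the form pi + qj. *)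
Require Import Defs.
From mathcomp Require Import all_boot all_order all_algebra all_field.
From mathcomp Require Import zify ring.
Set Implicit Arguments.
Unset Strict Implicit.
Unset Printing Implicit Defensive.
Import Order.TTheory GRing.Theory Num.Theory.
Local Open Scope ring_scope.

(** * Monic divisors as products of cyclotomic polynomials *)

(** Dividing by the monic ['Phi_n] stays in Z[X]. The remainder vanishes at [z] but is shorter than
    the minimal polynomial of [z] over Q, which has the size of ['Phi_n], so it is zero. *)
Lemma Cyclotomic_factor n (z : algC) (f : {poly int}) :
  n.-primitive_root z -> root (map_poly intr f) z ->
  exists h, f = 'Phi_n * h.
Proof.
move=> prim_z f_z; have monPhi := Cyclotomic_monic n.
have fE := Pdiv.RingMonic.rdivp_eq monPhi f.
set h := Pdiv.CommonRing.rdivp f _ in fE.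
set r := Pdiv.CommonRing.rmodp f _ in fE.
suff r0 : r = 0 by exists h; rewrite fE r0 addr0 mulrC.
have Phi_z : root (map_poly intr 'Phi_n) z.
  by rewrite (Cintr_Cyclotomic prim_z) root_cyclotomic.
have r_z : root (map_poly intr r) z.
  move: f_z; rewrite fE rmorphD rmorphM /= /root hornerD hornerM.
  by rewrite (eqP Phi_z) mulr0 add0r.
have [pm [pmE _] dv_pm] := minCpolyP z.
have size_pm : size pm = size 'Phi_n.
  rewrite -(size_map_poly (ratr : rat -> algC)) -pmE.
  rewrite (minCpoly_cyclotomic prim_z).
  by rewrite size_cyclotomic size_Cyclotomic.
have pm_r : pm %| map_poly intr r.
  rewrite -dv_pm -map_poly_comp; congr (root _ z): r_z.
  by apply: eq_map_poly => b; rewrite /= rmorph_int.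
apply/eqP; apply: contraTT pm_r => r_neq0; apply/negP => /dvdp_leq.
rewrite map_poly_eq0_id0 ?intr_eq0 ?lead_coef_eq0 // => /(_ r_neq0).
rewrite size_pm size_map_inj_poly //; last exact: intr_inj.
by rewrite leqNgt Pdiv.Ring.ltn_rmodpN0 // monic_neq0.
Qed.

Lemma Cyclotomic_prime n (f g h : {poly int}) :
  (0 < n)%N -> f * g = 'Phi_n * h ->
  (exists k, f = 'Phi_n * k) \/ (exists k, g = 'Phi_n * k).
Proof.
move=> /C_prim_root_exists[z prim_z] fgE.
have : root (map_poly intr (f * g)) z.
  rewrite fgE rmorphM /= rootM (Cintr_Cyclotomic prim_z).
  by rewrite root_cyclotomic prim_z.
by rewrite rmorphM rootM => /orP[] /(Cyclotomic_factor prim_z); [left | right].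
Qed.

(** Each ['Phi_d] is prime, so it can be stripped in turn from [f] or from its cofactor; the mask
    records which. What is left of [f] at the end is a monic unit. *)
Lemma monic_factor_prod_Cyclotomic (s : seq nat) (f g : {poly int}) :
  all (leq 1) s -> f \is monic -> f * g = \prod_(d <- s) 'Phi_d ->
  exists2 m : bitseq, size m = size s & f = \prod_(d <- mask m s) 'Phi_d.
Proof.
elim: s f g => [|d s IHs] f g /=.
  rewrite big_nil => _ monf fg1; exists [::]; rewrite ?big_nil //.
  have [c fE] : exists c, f = c%:P.
    have nz_fg : f * g != 0 by rewrite fg1 oner_eq0.
    have [nz_f nz_g] : f != 0 /\ g != 0.
      by apply/andP; rewrite -negb_or -mulf_eq0.
    have size_fg : size (f * g) = 1%N by rewrite fg1 size_poly1.
    rewrite size_mul // in size_fg; exists f`_0; apply: size1_polyC.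
    move: nz_f nz_g size_fg; rewrite -!size_poly_gt0.
    by move: (size f) (size g) => a b; lia.
  by move: monf; rewrite fE monicE lead_coefC => /eqP->.
case/andP=> d_gt0 s_gt0 monf; rewrite big_cons => fgE.
have nzPhi := monic_neq0 (Cyclotomic_monic d).
have [[k kE]|[k kE]] := Cyclotomic_prime d_gt0 fgE.
  have monk : k \is monic by move: monf; rewrite kE monicMl ?Cyclotomic_monic.
  have [|m sm kmE] := IHs k g s_gt0 monk.
    by apply: (mulfI nzPhi); rewrite -fgE kE mulrA.
  by exists (true :: m); rewrite /= ?sm // big_cons -kmE.
have [|m sm ->] := IHs f k s_gt0 monf.
  by apply: (mulfI nzPhi); rewrite -fgE kE mulrCA.
by exists (false :: m); rewrite /= ?sm.
Qed.

(** * Products of geometric sums *)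

(** The [[n]_d] of the introduction, that is, the quotient of X^(dn) - 1 by X^d - 1 when d > 0. *)
Definition geom (n d : nat) : {poly int} := \sum_(i < n) 'X^(d * i).

Lemma geomE n d : ('X^d - 1) * geom n d = 'X^(d * n) - 1.
Proof.
by rewrite exprM (subrX1 'X^d n) /geom; under eq_bigr do rewrite exprM.
Qed.

Lemma geomS n d : geom n.+1 d = geom n d + 'X^(d * n).
Proof. exact: big_ord_recr. Qed.

Lemma Xn_sub1_neq0 d : (0 < d)%N -> 'X^d - 1 != 0 :> {poly int}.
Proof. by move=> d_gt0; rewrite monic_neq0 ?monicXnsubC. Qed.

Lemma geom_mul m n d : (0 < d)%N -> geom m d * geom n (d * m) = geom (m * n) d.
Proof.
by move=> /Xn_sub1_neq0/mulfI; apply; rewrite mulrA !geomE mulnA.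
Qed.

Lemma geom_comp n d e : geom n d \Po 'X^e = geom n (e * d).
Proof.
rewrite /geom raddf_sum; apply: eq_bigr => i _ /=.
by rewrite comp_Xn_poly -exprM mulnA.
Qed.

Lemma coef_geom n d k :
  (0 < d)%N -> (geom n d)`_k = ((d %| k)%N && (k < d * n)%N)%:R.
Proof.
move=> d_gt0; elim: n => [|n IHn].
  by rewrite /geom big_ord0 coef0 muln0 ltn0 andbF.
rewrite geomS coefD IHn coefXn; case: (k =P (d * n)%N) => [->|kn].
  by rewrite dvdn_mulr // ltnn ltn_pmul2l ?ltnSn.
rewrite addr0; case: (boolP (d %| k)%N) => //= /dvdnP[c ck].
have c_n : c <> n by move=> cn; apply: kn; rewrite ck cn mulnC.
by congr (nat_of_bool _)%:R; rewrite ck mulnC !ltn_pmul2l //; lia.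
Qed.

Lemma coef_geom1 n k : (geom n 1)`_k = (k < n)%N%:R.
Proof. by rewrite coef_geom // dvd1n mul1n. Qed.

Lemma coef_geom_mul m a n b k :
  (geom m a * geom n b)`_k
    = #|[pred u : 'I_m * 'I_n | (a * u.1 + b * u.2 == k)%N]|%:R.
Proof.
rewrite /geom big_distrlr pair_bigA coef_sum -sum1_card natr_sum big_mkcond /=.
rewrite [RHS]big_mkcond /=; apply: eq_bigr => u _.
by rewrite -exprD coefXn eq_sym inE; case: ifP.
Qed.

(** The new term X^(dn) adds 1 at this exponent exactly as long as n < m. *)
Lemma coef_geom_mul_max m n d : (0 < d)%N -> (0 < m)%N ->
  (geom m d * geom n d)`_(d * m.-1) = (minn m n)%:R.
Proof.
move=> d_gt0 m_gt0; elim: n => [|n IHn].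
  by rewrite /geom !big_ord0 mulr0 coef0 minn0.
rewrite geomS mulrDr coefD {}IHn coefMXn coef_geom // -mulnBr dvdn_mulr //=.
rewrite !ltn_pmul2l //; case: ltnP => lt_n.
  by rewrite addr0; congr _%:R; lia.
by rewrite -natrD; congr _%:R; lia.
Qed.

(** * Ranges of coefficients, and products with coefficients 0 and 1 *)

Definition between (l u : nat) (x : int) := - l%:Z <= x <= u%:Z.

Lemma between_weaken l u l' u' x :
  (l <= l')%N -> (u <= u')%N -> between l u x -> between l' u' x.
Proof. by rewrite /between; lia. Qed.

Lemma between0 l u : between l u 0.
Proof. by rewrite /between; lia. Qed.

Lemma between_natr u n : (n <= u)%N -> between 0 u n%:R.
Proof. by rewrite /between natz; lia. Qed.

Lemma betweenD l u l' u' x y :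
  between l u x -> between l' u' y -> between (l + l') (u + u') (x + y).
Proof. by rewrite /between; lia. Qed.

Lemma betweenB l u l' u' x y :
  between l u x -> between l' u' y -> between (l + u') (u + l') (x - y).
Proof. by rewrite /between; lia. Qed.

Lemma betweenM l u v x y :
  between l u x -> between 0 v y -> between (l * v) (u * v) (x * y).
Proof. by rewrite /between; nia. Qed.

Lemma between_min u v x :
  between 0 u x -> between 0 v x -> between 0 (minn u v) x.
Proof. by rewrite /between; lia. Qed.

Definition coef_bounded (l u : nat) (f : {poly int}) :=
  forall k, between l u f`_k.

Lemma coef_bounded_weaken l u l' u' f :
  (l <= l')%N -> (u <= u')%N -> coef_bounded l u f -> coef_bounded l' u' f.
Proof. by move=> ll uu bf k; apply: between_weaken (bf k). Qed.

Lemma coef_bounded_min u v f :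
  coef_bounded 0 u f -> coef_bounded 0 v f -> coef_bounded 0 (minn u v) f.
Proof. by move=> bu bv k; apply: between_min. Qed.

Lemma coef_boundedB l u l' u' f g :
  coef_bounded l u f -> coef_bounded l' u' g ->
  coef_bounded (l + u') (u + l') (f - g).
Proof. by move=> bf bg k; rewrite coefB; apply: betweenB. Qed.

Lemma coef_bounded_Xn l u n f :
  coef_bounded l u f -> coef_bounded l u ('X^n * f).
Proof.
by move=> bf k; rewrite coefXnM; case: ifP => // _; apply: between0.
Qed.

Lemma coef_bounded_Xn_sub1 l u n f :
  coef_bounded l u f -> coef_bounded (l + u) (l + u) (('X^n - 1) * f).
Proof.
move=> bf; rewrite mulrBl mul1r [X in coef_bounded _ X]addnC.
exact: coef_boundedB (coef_bounded_Xn _ bf) bf.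
Qed.

Lemma coef_bounded_geom l u n d f :
  coef_bounded l u f -> coef_bounded (n * l) (n * u) (f * geom n d).
Proof.
move=> bf; elim: n => [|n IHn] k.
  by rewrite /geom big_ord0 mulr0 coef0; apply: between0.
rewrite geomS mulrDr coefD !mulSnr [f * 'X^_]mulrC.
exact: betweenD (IHn k) (coef_bounded_Xn _ bf k).
Qed.

Lemma coef_bounded0_geom n d f :
  coef_bounded 0 1 f -> coef_bounded 0 n (f * geom n d).
Proof. by move/(coef_bounded_geom n d); rewrite muln0 muln1. Qed.

(** All terms of the convolution are nonnegative, so one of them can be kept alone. *)
Lemma coef_mul_ge (f g : {poly int}) u v i j :
  coef_bounded 0 u f -> coef_bounded 0 v g -> f`_i * g`_j <= (f * g)`_(i + j).
Proof.
move=> bf bg; have lt_i : (i < (i + j).+1)%N by rewrite ltnS leq_addr.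
rewrite coefM (bigD1 (Ordinal lt_i)) //= addKn lerDl.
apply: sumr_ge0 => k _; apply: mulr_ge0.
  by case/andP: (bf k).
by case/andP: (bg (i + j - k)%N).
Qed.

(** If ai + bj = ai' + bj', then a divides gcd(a, b)|j - j'|, which is less than n gcd(a, b) <= a.
    Hence j = j', and each exponent arises at most once. *)
Lemma geom_mul_flat m a n b : (0 < a)%N -> (n * gcdn a b <= a)%N ->
  coef_bounded 0 1 (geom m a * geom n b).
Proof.
move=> a_gt0 na k; rewrite coef_geom_mul.
apply/between_natr/card_le1_eqP => -[[i lt_i] [j lt_j]] [[i' lt_i'] [j' lt_j']].
rewrite !inE /= => /eqP ij /eqP; rewrite -{}ij => ij.
have small t : (t < n)%N -> (a %| b * t)%N -> t = 0%N.
  move=> lt_t dv_t; apply/eqP; rewrite -leqn0 leqNgt; apply/negP => t_gt0.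
  have : (a %| gcdn a b * t)%N by rewrite muln_gcdl dvdn_gcd dvdn_mulr.
  move=> /dvdn_leq; rewrite muln_gt0 gcdn_gt0 a_gt0 t_gt0 => /(_ isT).
  rewrite leqNgt => /negP; apply; apply: leq_trans na.
  by rewrite mulnC ltn_pmul2r // gcdn_gt0 a_gt0.
have jj' : j = j'.
  case: (ltngtP j j') => // lt_jj.
    have bE : (b * (j' - j) = a * (i - i'))%N by rewrite !mulnBr; lia.
    by have := small (j' - j)%N; rewrite bE dvdn_mulr //; lia.
  have bE : (b * (j - j') = a * (i' - i))%N by rewrite !mulnBr; lia.
  by have := small (j - j')%N; rewrite bE dvdn_mulr //; lia.
have ii' : i = i' by apply/eqP; rewrite -(eqn_pmul2l a_gt0); apply/eqP; lia.
by congr (_, _); apply: val_inj.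
Qed.

Lemma geom_flat n d : (0 < d)%N -> coef_bounded 0 1 (geom n d).
Proof. by move=> d_gt0 k; rewrite coef_geom //; apply/between_natr/leq_b1. Qed.

(** The copies of [f] shifted by multiples of [d] do not overlap, so only the Euclidean division of
    [k] by [d] contributes. *)
Lemma coef_mul_comp_Xn (f g : {poly int}) d k : (0 < d)%N -> (size f <= d)%N ->
  (f * (g \Po 'X^d))`_k = f`_(k %% d) * g`_(k %/ d).
Proof.
move=> d_gt0 sz_f; rewrite coefM.
have lt_k : (k %% d < k.+1)%N by rewrite ltnS leq_mod.
rewrite (bigD1 (Ordinal lt_k)) //= big1 ?addr0 => [|j /eqP ne_j].
  rewrite coef_comp_poly_Xn // {2 4}(divn_eq k d) addnK dvdn_mull //.
  by rewrite mulnK.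
have [lt_j|le_j] := ltnP j d; last first.
  by rewrite nth_default ?mul0r ?(leq_trans sz_f).
rewrite coef_comp_poly_Xn //; case: dvdnP => [[c jc]|]; last by rewrite mulr0.
case: ne_j; apply: val_inj => /=; have := ltn_ord j; rewrite ltnS => le_jk.
have kE : (k = c * d + j)%N by rewrite -jc subnK.
by rewrite [X in _ = (X %% d)%N]kE modnMDl modn_small.
Qed.

Lemma coef_bounded_mul_comp_Xn l u v (f g : {poly int}) d :
  (0 < d)%N -> (size f <= d)%N ->
  coef_bounded l u f -> coef_bounded 0 v g ->
  coef_bounded (l * v) (u * v) (f * (g \Po 'X^d)).
Proof.
move=> d_gt0 sz_f bf bg k; rewrite coef_mul_comp_Xn //.
exact: betweenM.
Qed.

(* The coefficients of [H * geom N 1] below [N] are the partial sums of the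
   coefficients of [H]; those of [H * geom L 1] are differences of two of them. *)
Lemma coef_bounded_geom1 (H : {poly int}) N L : (size H <= N)%N ->
  coef_bounded 0 1 (H * geom N 1) -> coef_bounded 1 1 (H * geom L 1).
Proof.
move=> sz_H bH; pose T k := \sum_(j < k) H`_j.
have TS k : T k.+1 = T k + H`_k by rewrite /T big_ord_recr.
have T_HN k : (k < N)%N -> T k.+1 = (H * geom N 1)`_k.
  move=> lt_k; rewrite coefM; apply: eq_bigr => j _.
  by rewrite coef_geom1 (leq_ltn_trans (leq_subr _ _) lt_k) mulr1.
have T_big k : (N <= k)%N -> T k = T N.
  move=> /subnK <-; rewrite addnC; elim: (k - N)%N => [|i IHi].
    by rewrite addn0.
  rewrite addnS TS IHi nth_default ?addr0 //.
  by rewrite (leq_trans sz_H) ?leq_addr.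
have bT k : between 0 1 (T k).
  wlog le_k : k / (k <= N)%N.
    by case: (leqP k N) => [?|/ltnW/T_big->]; apply.
  case: k le_k => [|k] lt_k; first by rewrite /T big_ord0.
  by rewrite T_HN //; apply: bH.
(* For k < L the truncated difference is 0, and [T 0] is the empty sum. *)
have HL k : (H * geom L 1)`_k = T k.+1 - T (k.+1 - L)%N.
  elim: L => [|L IHL]; first by rewrite /geom big_ord0 mulr0 coef0 subn0 subrr.
  rewrite geomS mulrDr coefD {}IHL mul1n coefMXn subSS.
  case: ltnP => [lt_k|le_L].
    by rewrite addr0; congr (_ - T _); lia.
  by rewrite subSn // [T (_ - _).+1]TS opprD addrA subrK.
by move=> k; rewrite HL; apply: betweenB (bT _) (bT _).
Qed.

(** * Cyclotomic polynomials of index p^i and p^i q as geometric sums *)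

Lemma perm_divisors_pfactor p k : prime p ->
  perm_eq (divisors (p ^ k)) [seq p ^ i | i <- iota 0 k.+1]%N.
Proof.
move=> p_pr; apply: uniq_perm; first exact: divisors_uniq.
  by rewrite map_inj_uniq ?iota_uniq //; apply/expnI/prime_gt1.
move=> d; rewrite -dvdn_divisors ?expn_gt0 ?prime_gt0 //.
apply/(dvdn_pfactor _ _ p_pr)/mapP => -[i].
  by move=> le_i ->; exists i; rewrite ?mem_iota.
by rewrite mem_iota ltnS => /andP[_ le_i] ->; exists i.
Qed.

Lemma perm_divisors_pfactor_mul p q k : prime p -> prime q -> p != q ->
  perm_eq (divisors (p ^ k * q))
    ([seq p ^ i | i <- iota 0 k.+1] ++ [seq p ^ i * q | i <- iota 0 k.+1])%N.
Proof.
move=> p_pr q_pr pq; have q_gt0 := prime_gt0 q_pr.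
have pk_gt0 i : (0 < p ^ i)%N by rewrite expn_gt0 prime_gt0.
apply: uniq_perm; first exact: divisors_uniq.
  rewrite cat_uniq !map_inj_uniq ?iota_uniq ?andbT ?andTb; last 2 first.
  - move=> i j /eqP; rewrite eqn_pmul2r // => /eqP.
    exact/expnI/prime_gt1.
  - exact/expnI/prime_gt1.
  apply/hasP => -[d /mapP[i _ ->] /mapP[j _ pE]].
  have : (q %| p ^ j)%N by rewrite -pE dvdn_mull.
  by rewrite Euclid_dvdX // dvdn_prime2 // eq_sym (negPf pq).
move=> d; rewrite mem_cat -(perm_mem (perm_divisors_pfactor k p_pr)).
rewrite -!dvdn_divisors ?muln_gt0 ?pk_gt0 //.
apply/idP/orP => [|[/dvdn_mulr->|/mapP[i]] //]; last first.
  rewrite mem_iota ltnS => /andP[_ le_i] ->.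
  by rewrite dvdn_pmul2r // dvdn_exp2l.
have [/dvdnP[e ->]|ndv_q] := boolP (q %| d)%N.
  rewrite dvdn_pmul2r // => /(dvdn_pfactor _ _ p_pr)[i le_i ->].
  by right; apply/mapP; exists i; rewrite ?mem_iota.
by rewrite Gauss_dvdl; [left | rewrite coprime_sym prime_coprime].
Qed.

Lemma prod_Cyclotomic_pfactor p k : prime p ->
  \prod_(i <- iota 0 k.+1) 'Phi_(p ^ i) = 'X^(p ^ k) - 1.
Proof.
move=> p_pr; rewrite -prod_Cyclotomic ?expn_gt0 ?prime_gt0 //.
by rewrite (perm_big _ (perm_divisors_pfactor k p_pr)) big_map.
Qed.

Lemma Cyclotomic_pfactor p k : prime p -> 'Phi_(p ^ k.+1) = geom p (p ^ k).
Proof.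
move=> p_pr; have pk_gt0 : (0 < p ^ k)%N by rewrite expn_gt0 prime_gt0.
apply: (mulfI (Xn_sub1_neq0 pk_gt0)).
rewrite geomE -prod_Cyclotomic_pfactor // -expnSr -prod_Cyclotomic_pfactor //.
by rewrite -[in RHS]addn1 iotaD big_cat big_seq1.
Qed.

(** The divisors of p^k q are those of p^k and their multiples by q. Cancelling the first family
    divides X^(p^k q) - 1 by X^(p^k) - 1. *)
Lemma prod_Cyclotomic_pfactor_mul p q k : prime p -> prime q -> p != q ->
  \prod_(i <- iota 0 k.+1) 'Phi_(p ^ i * q) = geom q (p ^ k).
Proof.
move=> p_pr q_pr pq; have pk_gt0 : (0 < p ^ k)%N by rewrite expn_gt0 prime_gt0.
apply: (mulfI (Xn_sub1_neq0 pk_gt0)).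
have pkq_gt0 : (0 < p ^ k * q)%N by rewrite muln_gt0 pk_gt0 prime_gt0.
rewrite geomE -(prod_Cyclotomic pkq_gt0).
rewrite (perm_big _ (perm_divisors_pfactor_mul k p_pr q_pr pq)).
by rewrite big_cat !big_map prod_Cyclotomic_pfactor.
Qed.

Lemma geom1 d : geom 1 d = 1.
Proof. by rewrite /geom big_ord1 muln0. Qed.

Lemma size_geom n d : (0 < d)%N -> (size (geom n d) <= d * n)%N.
Proof.
move=> d_gt0; apply/leq_sizeP => k le_k.
by rewrite coef_geom // ltnNge le_k andbF.
Qed.

Lemma size_factor_geom (f g : {poly int}) n d :
  (0 < d)%N -> (0 < n)%N -> g * f = geom n d -> (size f <= d * n)%N.
Proof.
move=> d_gt0 n_gt0 gfE; apply: leq_trans (size_geom n d_gt0).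
have nz : geom n d != 0.
  apply/eqP => /(congr1 (fun h : {poly int} => h`_0)).
  by rewrite coef_geom // coef0 dvdn0 muln_gt0 d_gt0 n_gt0.
by rewrite -gfE in nz *; rewrite dvdp_leq // dvdp_mull.
Qed.

(** An exponent pi + qj = pq - p - q would make p divide q(j + 1), hence j + 1, while 0 < j + 1 <= c
    < p. *)
Lemma coef_geom_mul_Frobenius p q a b c k :
  (0 < p)%N -> coprime p q -> (c < p)%N -> (k + p + q = p * q)%N ->
  (geom a p * geom b p * geom c q)`_k = 0.
Proof.
move=> p_gt0 co_pq lt_c kE.
have -> : geom a p * geom b p = (geom a 1 * geom b 1) \Po 'X^p.
  by rewrite comp_polyM !geom_comp muln1.
rewrite /geom mulr_sumr coef_sum big1 // => j _.
rewrite coefMXn; case: ltnP => // le_j; rewrite coef_comp_poly_Xn //.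
case: ifP => // /dvdnP[i iE].
have : (p %| q * j.+1)%N.
  have qjE : (q * j.+1 + (i + 1) * p = q * p)%N by lia.
  by rewrite -(dvdn_addl _ (dvdn_mull (i + 1) (dvdnn p))) qjE dvdn_mull.
by rewrite Gauss_dvdr // => /dvdn_leq /= => /(_ isT); have := ltn_ord j; lia.
Qed.

(** * Coefficient bounds for the 64 products *)

(* [F] and [G] stand for [Phi_pq] and [Phi_p2q]. *)
Section DivisorBounds.

Variables (p q mu la : nat).
Hypotheses (p_pr : prime p) (q_pr : prime q) (p_neq_q : p != q).
Hypotheses (mu_gt0 : (0 < mu)%N) (mu_lt : (mu < q)%N).
Hypotheses (la_gt0 : (0 < la)%N) (la_lt : (la < p)%N).
Hypothesis mu_la : (p * mu + q * la = p * q + 1)%N.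
Variables F G : {poly int}.
Hypotheses (QF : geom q 1 * F = geom q p) (QFG : geom q p * G = geom q (p ^ 2)).

(** [M] and [B] are the claimed values of B_- and B_+. *)
Let M := (minn p mu + minn p (q - mu))%N.
Let B := minn (p ^ 2) q.

Let p_gt1 : (1 < p)%N := prime_gt1 p_pr.
Let q_gt1 : (1 < q)%N := prime_gt1 q_pr.
Let p_gt0 : (0 < p)%N := prime_gt0 p_pr.
Let q_gt0 : (0 < q)%N := prime_gt0 q_pr.
Let pq_gt0 : (0 < p * q)%N.
Proof. by rewrite muln_gt0 p_gt0. Qed.
Let p2_gt0 : (0 < p ^ 2)%N.
Proof. by rewrite expn_gt0 p_gt0. Qed.

Let co_pq : coprime p q.
Proof. by rewrite prime_coprime // dvdn_prime2. Qed.

Let geom_neq0 n d : (0 < n)%N -> (0 < d)%N -> geom n d != 0.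
Proof.
move=> n_gt0 d_gt0; apply: contraTneq (Xn_sub1_neq0 (d := d * n)%N _).
  by move=> g0; rewrite -geomE g0 mulr0 eqxx.
by rewrite muln_gt0 d_gt0.
Qed.

(** In these names [P], [PP] and [Q] stand for Phi_p = [geom p 1], Phi_p2 = [geom p p] and Phi_q =
    [geom q 1]. *)
Let PPP : geom p 1 * geom p p = geom (p ^ 2) 1.
Proof. by have := geom_mul p p (ltn0Sn 0); rewrite mul1n mulnn. Qed.

Let PF : geom p 1 * F = geom p q.
Proof.
apply: (mulfI (geom_neq0 q_gt0 (ltn0Sn 0))); rewrite mulrCA QF.
have := geom_mul p q (ltn0Sn 0); have := geom_mul q p (ltn0Sn 0).
by rewrite !mul1n mulnC => -> ->.
Qed.

Let PPG : geom p p * G = geom p (p * q).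
Proof.
apply: (mulfI (geom_neq0 q_gt0 p_gt0)).
by rewrite mulrCA QFG -mulnn !geom_mul // mulnC.
Qed.

Let size_F : (size F <= p * q)%N.
Proof. by rewrite mulnC; apply: size_factor_geom PF. Qed.

Let size_G : (size G <= p ^ 2 * q)%N.
Proof.
rewrite -mulnn -mulnA mulnC; exact: (size_factor_geom pq_gt0 p_gt0 PPG).
Qed.

Let size_FG : (size (F * G)%R <= p ^ 2 * q)%N.
Proof.
by apply: (size_factor_geom (g := geom q 1)) => //; rewrite mulrA QF.
Qed.

(** The Lam-Leung expression of Phi_pq. Multiplied by (X^p - 1)(X^q - 1), both sides become (X^(pq)
    - 1)(X - 1), because [mu_la] gives 1 + p(q - mu) = q la and 1 + q(p - la) = p mu. *)
Let F_eq : F = geom mu p * geom la q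
                 - 'X^1 * (geom (q - mu) p * geom (p - la) q).
Proof.
apply: (mulfI (Xn_sub1_neq0 p_gt0)); apply: (mulfI (Xn_sub1_neq0 q_gt0)).
transitivity (('X^(p * q) - 1) * ('X^1 - 1) : {poly int}).
  have <- : ('X^1 - 1) * geom q 1 = 'X^q - 1 by rewrite geomE mul1n.
  by rewrite -geomE -QF; ring.
have Xmu' : 'X^1 * 'X^(p * (q - mu)) = 'X^(q * la) :> {poly int}.
  by rewrite -exprD mulnBr; congr 'X^_; nia.
have Xla' : 'X^1 * 'X^(q * (p - la)) = 'X^(p * mu) :> {poly int}.
  by rewrite -exprD mulnBr; congr 'X^_; nia.
have Xla : 'X^(q * la) * 'X^(q * (p - la)) = 'X^(p * q) :> {poly int}.
  by rewrite -exprD mulnBr; congr 'X^_; nia.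
have Xmu : 'X^(p * mu) * 'X^(q * la) = 'X^(p * q) * 'X^1 :> {poly int}.
  by rewrite -!exprD mu_la.
transitivity ((('X^p - 1) * geom mu p) * (('X^q - 1) * geom la q)
  - 'X^1 * ((('X^p - 1) * geom (q - mu) p) * (('X^q - 1) * geom (p - la) q))).
  rewrite !geomE.
  transitivity ('X^(p * mu) * 'X^(q * la) - 'X^(p * mu) - 'X^(q * la) + 1
    - 'X^1 * 'X^(p * (q - mu)) * 'X^(q * (p - la)) + 'X^1 * 'X^(p * (q - mu))
    + 'X^1 * 'X^(q * (p - la)) - 'X^1 : {poly int}); last by ring.
  by rewrite Xmu Xmu' Xla Xla'; ring.
by ring.
Qed.


Let F1 := geom mu p * geom p p * geom la q.
Let F2 := geom (q - mu) p * geom p p * geom (p - la) q.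

Let PPF : geom p p * F = F1 - 'X^1 * F2.
Proof. by rewrite F_eq /F1 /F2; ring. Qed.

(** Either sum in X^p times [geom n q] has coefficients 0 and 1 by coprimality; the remaining sum
    adds up p, respectively m, shifted copies. *)
Let geom3_bounded m n : (n <= p)%N ->
  coef_bounded 0 (minn p m) (geom m p * geom p p * geom n q).
Proof.
move=> le_np; have flat c : coef_bounded 0 1 (geom c p * geom n q).
  by apply: geom_mul_flat => //; rewrite (eqP co_pq) muln1.
apply: coef_bounded_min; first by rewrite mulrAC; apply: coef_bounded0_geom.
by rewrite -mulrA mulrC; apply: coef_bounded0_geom.
Qed.

Let PPF_coef_bounded :
  coef_bounded (minn p (q - mu)) (minn p mu) (geom p p * F).
Proof.
rewrite PPF; have := coef_boundedB (geom3_bounded mu (ltnW la_lt))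
  (coef_bounded_Xn 1 (geom3_bounded (q - mu) (leq_subr la p))).
by rewrite add0n addn0.
Qed.

(** The exponent combines the peak of [geom c p * geom p p] with the top term of [geom m q]. *)
Let geom3_coef_ge c m : (0 < c)%N -> (0 < m)%N ->
  (minn c p)%:Z
    <= (geom c p * geom p p * geom m q)`_(p * c.-1 + q * m.-1).
Proof.
move=> c_gt0 m_gt0.
have := coef_mul_ge (p * c.-1) (q * m.-1)
  (coef_bounded0_geom p p (geom_flat c p_gt0)) (geom_flat m q_gt0).
rewrite coef_geom_mul_max // coef_geom // dvdn_mulr // ltn_pmul2l //.
by rewrite prednK // leqnn mulr1 natz.
Qed.

Lemma coef_min_attained :
  (('X^1 - 1) * (geom p p * F))`_(p * mu.-1 + q * la.-1) = - M%:Z.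
Proof.
set n := (p * mu.-1 + q * la.-1)%N.
have pred_mul a b : (0 < b)%N -> (a * b.-1 + a = a * b)%N.
  by move=> b_gt0; rewrite -mulnSr prednK.
have := pred_mul p _ mu_gt0; have := pred_mul q _ la_gt0 => la_pred mu_pred.
have n_gt0 : (0 < n)%N.
  have ltpq : (p + q < p * q + 1)%N.
    rewrite -(prednK p_gt0) -(prednK q_gt0) mulSn mulnS.
    have : (0 < p.-1 * q.-1)%N by rewrite muln_gt0 -!subn1 !subn_gt0 p_gt1.
    by lia.
  by rewrite /n; lia.
have n_gt1 : (1 < n)%N.
  move: n_gt0; rewrite /n; case: mu.-1 => [|a] => [|_]; last first.
    by rewrite mulnS -addnA (leq_trans p_gt1) ?leq_addr.
  case: la.-1 => [|b]; rewrite muln0 add0n ?muln0 // => _.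
  by rewrite mulnS (leq_trans q_gt1) ?leq_addr.
have nE : (n + p + q = p * q + 1)%N by rewrite /n; lia.
(* The factor X - 1 and the shift of [F2] by X bring in [F2] at n - 2, which is the exponent where
   [geom3_coef_ge] applies to [F2]. *)
have n2E : n.-2 = (p * (q - mu).-1 + q * (p - la).-1)%N.
  have := pred_mul p (q - mu)%N; have := pred_mul q (p - la)%N.
  have : (p * mu <= p * q)%N by rewrite leq_mul2l (ltnW mu_lt) orbT.
  have : (q * la <= p * q)%N by rewrite mulnC leq_mul2r (ltnW la_lt) orbT.
  rewrite !subn_gt0 la_lt mu_lt !mulnBr [(q * p)%N]mulnC.
  move: (q - mu).-1 (p - la).-1 mu_la nE => a b.
  move: (p * a)%N (q * b)%N (p * mu)%N (q * la)%N (p * q)%N (n).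
  by clear; lia.
have F1n := geom3_coef_ge mu_gt0 la_gt0.
have F2n : (minn (q - mu) p)%:Z <= F2`_n.-2.
  by rewrite n2E; apply: geom3_coef_ge; rewrite subn_gt0.
(* n - 1 is the Frobenius number, so the two terms of opposite sign, [F1] and [F2] at n - 1,
   vanish. *)
have n1E : (n.-1 + p + q = p * q)%N.
  by apply/eqP; rewrite -eqSS -!addSn prednK // nE addn1.
have F10 : F1`_n.-1 = 0 by apply: coef_geom_mul_Frobenius n1E.
have F20 : F2`_n.-1 = 0.
  by apply: coef_geom_mul_Frobenius n1E; rewrite // ltn_subrL la_gt0.
(* The general bound gives at least -M; [F1n] and [F2n] give at most -M. *)
have := coef_bounded_Xn_sub1 1 PPF_coef_bounded n.
rewrite mulrBl mul1r coefB coefXnM ltnNge n_gt0 /= PPF !coefB.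
rewrite !coefXnM !subn1 F10 F20 if_same sub0r subr0.
have -> : (n.-1 < 1)%N = false by rewrite ltnNge -ltnS prednK // n_gt1.
rewrite /between /M !(minnC p); move: F1n F2n.
move: F1`_n F2`_n.-2 (minn mu p) (minn (q - mu) p).
by clear; lia.
Qed.

Let M_ge : (minn p q <= M)%N.
Proof. by move: mu_lt; rewrite /M; clear; lia. Qed.

(** M is at most 2p <= p^2, and at most mu + (q - mu) = q. *)
Let M_le : (M <= B)%N.
Proof.
have : (p + p <= p ^ 2)%N by rewrite addnn -mul2n leq_pmul2r.
by move: mu_lt; rewrite /M /B; clear; lia.
Qed.

Let M_ge2 : (2 <= M)%N.
Proof. by apply: leq_trans M_ge; rewrite leq_min p_gt1. Qed.

(** Pairing each product with its multiple by Phi_1 lets 32 cases cover the 64 divisors. *)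
Definition divisor_bounded (f : {poly int}) :=
  coef_bounded M B f /\ coef_bounded M B (('X^1 - 1) * f).

Let flat f : coef_bounded 1 1 f -> divisor_bounded f.
Proof.
move=> bf; have M_ge1 := ltnW M_ge2; split.
  by apply: coef_bounded_weaken bf; rewrite ?(leq_trans _ M_le).
apply: coef_bounded_weaken (coef_bounded_Xn_sub1 1 bf) => //.
exact: leq_trans M_le.
Qed.

Let flat01 f : coef_bounded 0 1 f -> divisor_bounded f.
Proof. by move=> bf; apply: flat; apply: coef_bounded_weaken bf. Qed.

Let geom_bounded n d : (0 < d)%N -> divisor_bounded (geom n d).
Proof. by move=> d_gt0; apply/flat01/geom_flat. Qed.

Let geom_mul_bounded m a n b : (0 < a)%N -> (n * gcdn a b <= a)%N ->
  divisor_bounded (geom m a * geom n b).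
Proof. by move=> *; apply/flat01/geom_mul_flat. Qed.

(** The product is a sum of m, and also of k, shifted polynomials with coefficients 0 and 1. The
    factor X - 1 turns [geom m 1] into X^m - 1, leaving height at most 1. *)
Let nneg_bounded m k e g h : g * geom m 1 = h * geom k e ->
  coef_bounded 0 1 g -> coef_bounded 0 1 h -> (minn m k <= B)%N ->
  divisor_bounded (g * geom m 1).
Proof.
move=> ghE bg bh le_B; split.
  apply: (coef_bounded_weaken (leq0n M) le_B).
  by apply: coef_bounded_min; last rewrite ghE; apply: coef_bounded0_geom.
rewrite mulrCA geomE mul1n mulrC.
apply: coef_bounded_weaken (coef_bounded_Xn_sub1 m bg).
  exact: ltnW M_ge2.
exact: leq_trans (ltnW M_ge2) M_le.
Qed.

Let min_pq : (minn p q <= B)%N.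
Proof. exact: leq_trans M_ge M_le. Qed.

(** This is a polynomial in X^p. Since p > 1, its products with X and with -1 do not overlap, so X -
    1 does not raise the height min(p, q). *)
Let PPQF_bounded : divisor_bounded (geom p p * geom q p).
Proof.
have bf : coef_bounded 0 (minn p q) (geom p p * geom q p).
  apply: coef_bounded_min; last exact/coef_bounded0_geom/geom_flat.
  by rewrite mulrC; apply/coef_bounded0_geom/geom_flat.
split; first exact: coef_bounded_weaken bf.
have bf1 : coef_bounded 0 (minn p q) (geom p 1 * geom q 1).
  apply: coef_bounded_min; last exact/coef_bounded0_geom/geom_flat.
  by rewrite mulrC; apply/coef_bounded0_geom/geom_flat.
have -> : geom p p * geom q p = (geom p 1 * geom q 1) \Po 'X^p.
  by rewrite comp_polyM !geom_comp muln1.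
have bX : coef_bounded 1 1 ('X^1 - 1).
  by have := coef_bounded_Xn_sub1 1 (geom_flat 1 p_gt0); rewrite geom1 mulr1.
have := coef_bounded_mul_comp_Xn p_gt0 _ bX bf1.
rewrite size_XnsubC // !mul1n => /(_ p_gt1).
exact: coef_bounded_weaken.
Qed.

Let PPF_bounded : divisor_bounded (geom p p * F).
Proof.
have le1 : (minn p (q - mu) <= M)%N by apply: leq_addl.
have le2 : (minn p mu <= M)%N by apply: leq_addr.
split.
  apply: coef_bounded_weaken PPF_coef_bounded => //.
  exact: leq_trans M_le.
apply: coef_bounded_weaken (coef_bounded_Xn_sub1 1 PPF_coef_bounded).
  by rewrite addnC.
by rewrite addnC.
Qed.

Let geom_pq : geom (p * q) 1 = geom p 1 * geom q p.
Proof. by rewrite -geom_mul // mul1n. Qed.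

Let geom_p2q : geom (p ^ 2 * q) 1 = geom p 1 * geom p p * geom q (p ^ 2).
Proof. by rewrite PPP -geom_mul // mul1n. Qed.

Let coprime_flat m n a b : (0 < a)%N -> coprime a b -> (n <= a)%N ->
  coef_bounded 0 1 (geom m a * geom n b).
Proof.
move=> a_gt0 co_ab le_n.
by apply: geom_mul_flat; rewrite ?(eqP co_ab) ?muln1.
Qed.

(** By [coef_bounded_geom1] it suffices to take L = pq, where the product is [p]_q [q]_p. *)
Let F_flat L : coef_bounded 1 1 (F * geom L 1).
Proof.
apply: coef_bounded_geom1 size_F _.
by rewrite geom_pq mulrA [F * _]mulrC PF mulrC; apply: coprime_flat.
Qed.

(** For L = p^2 q the product is [p]_1 times [p]_q [q]_p evaluated at X^p, and [p]_1 is short enough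
    for the copies not to overlap. *)
Let G_flat L : coef_bounded 1 1 (G * geom L 1).
Proof.
apply: coef_bounded_geom1 size_G _.
have -> : G * geom (p ^ 2 * q) 1
    = geom p 1 * ((geom p q * geom q p) \Po 'X^p).
  rewrite comp_polyM !geom_comp mulnn -PPG geom_p2q -!mulrA mulrCA.
  by congr (_ * _); rewrite mulrCA.
have size_P : (size (geom p 1) <= p)%N.
  by have := size_geom p (ltn0Sn 0); rewrite mul1n.
apply: (@coef_bounded_mul_comp_Xn 0 1 1 _ _ _ p_gt0 size_P) => //.
  exact: geom_flat.
by rewrite mulrC; apply: coprime_flat.
Qed.

Let FG_flat L : coef_bounded 1 1 (F * G * geom L 1).
Proof.
apply: coef_bounded_geom1 size_FG _.
have -> : F * G * geom (p ^ 2 * q) 1 = geom q (p ^ 2) * geom (p ^ 2) q.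
  rewrite geom_p2q -[X in geom X q]mulnn -geom_mul //.
  by rewrite -PF [(q * p)%N]mulnC -PPG; ring.
by apply: coprime_flat; rewrite ?coprimeXl.
Qed.

(** Expanding either geometric sum bounds the height by p and by q. With X - 1, the sum [p]_1
    collapses to X^p - 1, and the height is at most 2. *)
Let PQG_bounded : divisor_bounded (G * geom q 1 * geom p 1).
Proof.
have bP : coef_bounded p p (G * geom q 1 * geom p 1).
  by have := coef_bounded_geom p 1 (G_flat q); rewrite muln1.
have bQ : coef_bounded q q (G * geom q 1 * geom p 1).
  by have := coef_bounded_geom q 1 (G_flat p); rewrite muln1 mulrAC.
split.
  apply: (@coef_bounded_weaken (minn p q) (minn p q)) => // k.
  by move: (bP k) (bQ k); rewrite /between; move: _`_k; clear; lia.
rewrite mulrCA geomE mul1n mulrC.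
apply: coef_bounded_weaken (coef_bounded_Xn_sub1 p (G_flat q)) => //.
exact: leq_trans M_le.
Qed.

Let unit_flat m n d : (0 < d)%N -> (n <= d)%N ->
  coef_bounded 0 1 (geom m d * geom n 1).
Proof. by move=> *; apply: geom_mul_flat; rewrite ?gcdn1 ?muln1. Qed.

Let p_le_pq : (p <= p * q)%N.
Proof. by rewrite leq_pmulr. Qed.

Let q_le_pq : (q <= p * q)%N.
Proof. by rewrite leq_pmull. Qed.

Let p_le_p2 : (p <= p ^ 2)%N.
Proof. by rewrite -mulnn leq_pmulr. Qed.

(** The cases run from the full product to the empty one. The relations [PPP], [PF], [PPG], [QF] and
    [QFG] absorb [F] and [G] wherever they apply. *)
Lemma divisor_bounded_mask (m : bitseq) : size m = 5%N ->
  divisor_bounded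
    (\prod_(f <- mask m [:: geom p 1; geom p p; geom q 1; F; G]) f).
Proof.
case: m => [|b1 [|b2 [|b3 [|b4 [|b5 []]]]]] // _.
case: b1 b2 b3 b4 b5 => [] [] [] [] []; rewrite /= ?big_cons big_nil ?mulr1.
- rewrite [geom q 1 * _]mulrA QF QFG mulrA -geom_p2q.
  exact: geom_bounded.
- rewrite QF mulrA PPP mulrC.
  by apply: (nneg_bounded (mulrC _ _)); rewrite //; apply: geom_flat.
- rewrite [geom p p * _]mulrCA PPG mulrC.
  apply: (@nneg_bounded p q 1 _ (geom p (p * q) * geom p 1)) => //.
  + by ring.
  + by rewrite [geom q 1 * _]mulrC; apply: unit_flat.
  + exact: unit_flat.
(* The product [q]_1 [p^2]_1, whose largest coefficient is [B]. *)
- rewrite mulrA PPP mulrC.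
  by apply: (nneg_bounded (mulrC _ _)); rewrite //; apply: geom_flat.
- rewrite [geom p p * _]mulrCA PPG mulrA PF [(p * q)%N]mulnC geom_mul //.
  exact: geom_bounded.
- rewrite mulrCA PF; apply: geom_mul_bounded => //.
  by rewrite (eqP co_pq) muln1.
- by rewrite PPG [geom p 1 * _]mulrC; apply/flat01/unit_flat.
- by rewrite PPP; apply: geom_bounded.
- by rewrite [geom q 1 * _]mulrA QF QFG mulrC; apply/flat01/unit_flat.
- by rewrite QF -geom_pq; apply: geom_bounded.
- by rewrite mulrC [geom q 1 * G]mulrC; apply: PQG_bounded.
- rewrite mulrC.
  by apply: (nneg_bounded (mulrC _ _)); rewrite //; apply: geom_flat.
- by rewrite mulrC; apply/flat/FG_flat.
- by rewrite PF; apply: geom_bounded.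
- by rewrite mulrC; apply/flat/G_flat.
- exact: geom_bounded.
(* The equality case of the gcd condition: p gcd(p^2, p) = p^2. *)
- rewrite [geom q 1 * _]mulrA QF QFG mulrC; apply: geom_mul_bounded => //.
  by rewrite -{2}mulnn leq_mul2l gcdnC dvdn_leq ?dvdn_gcdl ?orbT.
- by rewrite QF; apply: PPQF_bounded.
- rewrite mulrCA PPG [geom q 1 * _]mulrC.
  by apply/flat01/unit_flat.
- apply: (nneg_bounded (mulrC _ _)); rewrite ?[minn q p]minnC //.
    exact: geom_flat.
  exact: geom_flat.
(* Here [F] multiplies a polynomial in X^(pq), and [size_F] prevents any overlap. *)
- rewrite mulrCA PPG; apply: flat.
  have -> : geom p (p * q) = geom p 1 \Po 'X^(p * q) by rewrite geom_comp muln1.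
  have bF : coef_bounded 1 1 F by have := F_flat 1; rewrite geom1 mulr1.
  exact: (coef_bounded_mul_comp_Xn pq_gt0 size_F bF (geom_flat p (ltn0Sn 0))).
- exact: PPF_bounded.
- by rewrite PPG; apply: geom_bounded.
- exact: geom_bounded.
- by rewrite mulrA QF QFG; apply: geom_bounded.
- by rewrite QF; apply: geom_bounded.
- by rewrite mulrC; apply/flat/G_flat.
- exact: geom_bounded.
- by rewrite -[_ * _]mulr1 -(geom1 1); apply/flat/FG_flat.
- by rewrite -[F]mulr1 -(geom1 1); apply/flat/F_flat.
- by rewrite -[G]mulr1 -(geom1 1); apply/flat/G_flat.
- by rewrite -(geom1 1); apply: geom_bounded.
Qed.
End DivisorBounds.

(** * The divisors of X^(p^2 q) - 1 and the two extremal coefficients *)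

Section DivisorsOfXp2qSub1.

Variables p q : nat.
Hypotheses (p_pr : prime p) (q_pr : prime q) (p_neq_q : p != q).

Let Phi_1 : 'Phi_1 = 'X^1 - 1.
Proof. by rewrite -prod_Cyclotomic ?big_seq1. Qed.

Let Phi_p : 'Phi_p = geom p 1.
Proof. exact: (Cyclotomic_pfactor 0). Qed.

Let Phi_p2 : 'Phi_(p ^ 2) = geom p p.
Proof. by rewrite Cyclotomic_pfactor. Qed.

Let Phi_q : 'Phi_q = geom q 1.
Proof. exact: (Cyclotomic_pfactor 0). Qed.

Let Phi_pq : geom q 1 * 'Phi_(p * q) = geom q p.
Proof.
have := prod_Cyclotomic_pfactor_mul 1 p_pr q_pr p_neq_q.
by rewrite /= !big_cons big_nil mulr1 expn0 mul1n Phi_q expn1.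
Qed.

Let Phi_p2q : geom q p * 'Phi_(p ^ 2 * q) = geom q (p ^ 2).
Proof.
have := prod_Cyclotomic_pfactor_mul 2 p_pr q_pr p_neq_q.
rewrite /= !big_cons big_nil mulr1 expn0 mul1n Phi_q expn1.
by rewrite mulrA Phi_pq.
Qed.

(** The index 1 comes first, so that the leading bit of a mask decides whether X - 1 occurs; the
    rest follows the order in [divisor_bounded_mask]. *)
Let Phi_seq := [:: 1; p; p ^ 2; q; p * q; p ^ 2 * q]%N.

Let prod_Phi : \prod_(d <- Phi_seq) 'Phi_d = 'X^(p ^ 2 * q) - 1.
Proof.
rewrite -prod_Cyclotomic ?muln_gt0 ?expn_gt0 ?prime_gt0 //.
rewrite [RHS](perm_big _ (perm_divisors_pfactor_mul 2 p_pr q_pr p_neq_q)) /=.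
by rewrite expn0 expn1 mul1n.
Qed.

Variables (mu la : nat).
Hypotheses (mu_gt0 : (0 < mu)%N) (mu_lt : (mu < q)%N).
Hypotheses (la_gt0 : (0 < la)%N) (la_lt : (la < p)%N).
Hypothesis mu_la : (p * mu + q * la = p * q + 1)%N.

Lemma monic_divisor_bounded (f : {poly int}) :
  monic_divisor (p ^ 2 * q) f ->
  coef_bounded (minn p mu + minn p (q - mu)) (minn (p ^ 2) q) f.
Proof.
case=> monf [g /esym]; rewrite -prod_Phi => fgE.
have gt0 : all (leq 1) Phi_seq.
  by rewrite /= ?muln_gt0 ?expn_gt0 !prime_gt0.
have [m /= sz_m ->] := monic_factor_prod_Cyclotomic gt0 monf fgE.
case: m sz_m => [|b m] // [sz_m].
have [b1 b2] := divisor_bounded_mask p_pr q_pr p_neq_q mu_gt0 mu_lt la_gt0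
  la_lt mu_la Phi_pq Phi_p2q sz_m.
have mE : \prod_(d <- mask m [:: p; p ^ 2; q; p * q; p ^ 2 * q]%N) 'Phi_d =
  \prod_(f <- mask m [:: geom p 1; geom p p; geom q 1; 'Phi_(p * q);
                         'Phi_(p ^ 2 * q)]) f.
  by rewrite -(big_map Cyclotomic xpredT id) map_mask /= Phi_p Phi_p2 Phi_q.
by case: b; rewrite /= ?big_cons ?Phi_1 mE.
Qed.

(** Coefficients past the size default to 0, so [c != 0] puts the index in range. *)
Lemma divisor_coef_attained (f g : {poly int}) k c :
  f \is monic -> f * g = 'X^(p ^ 2 * q) - 1 -> f`_k = c -> c != 0 ->
  divisor_coef (p ^ 2 * q) c.
Proof.
move=> monf fgE fk nz_c; exists f; split; first by split; last exists g.
exists k; rewrite ?fk // ltnNge; apply: contra nz_c => le_k.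
by rewrite -fk nth_default.
Qed.

Lemma Bminus_p2q :
  is_Bminus (p ^ 2 * q) (minn p mu + minn p (q - mu))%N.
Proof.
split; last first.
  by move=> c [f [/monic_divisor_bounded bf [i _ ->]]]; case/andP: (bf i).
have := coef_min_attained p_pr q_pr p_neq_q mu_gt0 mu_lt la_gt0
  la_lt mu_la Phi_pq Phi_p2q.
rewrite -Phi_1 -Phi_p2 => coefE.
apply: (divisor_coef_attained (g := 'Phi_p * 'Phi_q * 'Phi_(p ^ 2 * q))
  _ _ coefE).
- by rewrite !rpredM ?Cyclotomic_monic.
- by rewrite -prod_Phi !big_cons big_nil mulr1; ring.
- have := prime_gt0 p_pr; move: mu_gt0; clear; lia.
Qed.

Lemma Bplus_p2q : is_Bplus (p ^ 2 * q) (minn (p ^ 2) q).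
Proof.
split; last first.
  by move=> c [f [/monic_divisor_bounded bf [i _ ->]]]; case/andP: (bf i).
(* The peak of [p^2]_1 [q]_1, read at exponent p^2 - 1. *)
have := coef_geom_mul_max q (ltn0Sn 0) (_ : (0 < p ^ 2)%N).
rewrite expn_gt0 prime_gt0 // natz => /(_ isT).
rewrite -[X in geom X 1]mulnn -geom_mul // mul1n -Phi_p -Phi_p2 -Phi_q.
move=> coefE; apply: (divisor_coef_attained
  (g := 'Phi_1 * 'Phi_(p * q) * 'Phi_(p ^ 2 * q)) _ _ coefE).
- by rewrite !rpredM ?Cyclotomic_monic.
- by rewrite -prod_Phi !big_cons big_nil mulr1; ring.
- have := prime_gt0 q_pr; have := prime_gt0 p_pr; clear; nia.
Qed.

End DivisorsOfXp2qSub1.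

Theorem theorem4 (p q pstar : nat)
  (p_prime : prime p) (q_prime : prime q) (p_neq_q : p != q)
  (pstar_range : (1 <= pstar <= q - 1)%N)
  (pstar_inv : (p * pstar = 1 %[mod q])%N) :
  is_Bminus (p ^ 2 * q)%N (minn p pstar + minn p (q - pstar))%N%:Z /\
  is_Bplus (p ^ 2 * q)%N (minn (p ^ 2) q)%:Z.
Proof.
have p_gt1 := prime_gt1 p_prime; have q_gt1 := prime_gt1 q_prime.
have [ps_gt0 ps_lt] : (0 < pstar)%N /\ (pstar < q)%N by lia.
(* From p pstar = qt + 1, the choice la = p - t gives p pstar + q la = pq + 1. Here t > 0 because p
   pstar > 1, and t < p because pstar < q. *)
pose t := ((p * pstar) %/ q)%N.
have tE : (p * pstar = q * t + 1)%N.
  by rewrite {1}(divn_eq (p * pstar) q) pstar_inv modn_small // mulnC.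
have t_gt0 : (0 < t)%N.
  by rewrite lt0n; apply/eqP => t0; move: tE; rewrite t0; nia.
have t_lt : (t < p)%N.
  by rewrite ltnNge; apply/negP => le_pt; move: tE; nia.
have la_gt0 : (0 < p - t)%N by rewrite subn_gt0.
have la_lt : (p - t < p)%N by lia.
have mu_la : (p * pstar + q * (p - t) = p * q + 1)%N.
  by rewrite tE mulnBr [(q * p)%N]mulnC; nia.
split.
  exact: Bminus_p2q ps_gt0 ps_lt la_gt0 la_lt mu_la.
exact: Bplus_p2q ps_gt0 ps_lt la_gt0 la_lt mu_la.
Qed.
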